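(* Let $X$ be a topological space and let $f,g:X\to\mathbb{R}$ be functions, not necessarily continuous. Let $F,G:(\mathbb{R},\leq)\to\mathbf{Top}$ be the diagrams given by $F(a)=f^{-1}(-\infty,a]$ and $G(a)=g^{-1}(-\infty,a]$ (with the subspace topology) for $a\in\mathbb{R}$, with $F(a\leq b)$ and $G(a\leq b)$ the inclusions. Let $\mathbf{D}$ be any category and $H:\mathbf{Top}\to\mathbf{D}$ any functor. Then $$d(HF,HG)\leq\|f-g\|_\infty.$$
   Context: $(\mathbb{R},\leq)$ denotes the poset of real numbers viewed as a category; $\mathbf{Top}$ is the category of topological spaces and continuous maps; $\|f-g\|_\infty=\sup_{x\in X}|f(x)-g(x)|\in[0,\infty]$. For $b\geq 0$, $T_b:(\mathbb{R},\leq)\to(\mathbb{R},\leq)$ is the functor $T_b(a)=a+b$. For $\varepsilon\geq 0$, functors $P,Q:(\mathbb{R},\leq)\to\mathbf{D}$ are $\varepsilon$-interleaved if there are natural transformations $\varphi:P\Rightarrow QT_\varepsilon$ and $\psi:Q\Rightarrow PT_\varepsilon$ such that for all $a\in\mathbb{R}$, $\psi(a+\varepsilon)\varphi(a)=P(a\leq a+2\varepsilon)$ and $\varphi(a+\varepsilon)\psi(a)=Q(a\leq a+2\varepsilon)$. The interleaving distance is $d(P,Q)=\inf\{\varepsilon\geq 0\mid P\text{ and }Q\text{ are }\varepsilon\text{-interleaved}\}$, equal to $\infty$ if there is no such $\varepsilon$. *)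

(* Defs.v *)
From HB Require Import structures.
From mathcomp Require Import all_boot all_order all_algebra.
From mathcomp Require Import boolp classical_sets functions set_interval.
From mathcomp Require Import reals ereal topology.

Set Implicit Arguments.
Unset Strict Implicit.
Unset Printing Implicit Defensive.

Import Order.TTheory GRing.Theory Num.Theory.

Local Open Scope classical_set_scope.
Local Open Scope ring_scope.

Record category := Category {
  obj :> Type;
  mor : obj -> obj -> Type;
  idm : forall a, mor a a;
  compm : forall a b c, mor b c -> mor a b -> mor a c;
  compm_idl : forall a b (u : mor a b), compm (idm b) u = u;
  compm_idr : forall a b (u : mor a b), compm u (idm a) = u;
  compmA : forall a b c d (w : mor c d) (v : mor b c) (u : mor a b),
    compm w (compm v u) = compm (compm w v) u
}.

Arguments mor {_} a b : rename.
Arguments idm {_} a : rename.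
Arguments compm {_ _ _ _} v u : rename.

Notation "v \oM u" := (compm v u) (at level 50, left associativity).

Record functor (C D : category) := Functor {
  fobj :> C -> D;
  fmor : forall a b : C, mor a b -> mor (fobj a) (fobj b);
  fmor_id : forall a, fmor (idm a) = idm (fobj a);
  fmor_comp : forall (a b c : C) (v : mor b c) (u : mor a b),
    fmor (v \oM u) = fmor v \oM fmor u
}.

Arguments fmor {C D} f {a b}.

Section functor_composition.
Variables (C D E : category) (Q : functor D E) (P : functor C D).

Let comp_mor (a b : C) (u : mor a b) : mor (Q (P a)) (Q (P b)) :=
  fmor Q (fmor P u).

Fact comp_mor_id a : comp_mor (idm a) = idm (Q (P a)).
Proof. by rewrite /comp_mor !fmor_id. Qed.

Fact comp_mor_comp (a b c : C) (v : mor b c) (u : mor a b) :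
  comp_mor (v \oM u) = comp_mor v \oM comp_mor u.
Proof. by rewrite /comp_mor !fmor_comp. Qed.

Definition comp_functor : functor C E := Functor comp_mor_id comp_mor_comp.

End functor_composition.

Notation "Q \oF P" := (comp_functor Q P) (at level 50, left associativity).

Record nat_trans (C D : category) (P Q : functor C D) := NatTrans {
  nat_comp :> forall a : C, mor (P a) (Q a);
  naturality : forall (a b : C) (u : mor a b),
    nat_comp b \oM fmor P u = fmor Q u \oM nat_comp a
}.

Section top_category.

Let top_comp (X Y Z : topologicalType)
  (v : continuousType Y Z) (u : continuousType X Y) : continuousType X Z :=
  v \o u.

Fact top_comp_idl (X Y : topologicalType) (u : continuousType X Y) :
  top_comp idfun u = u.
Proof. exact/continuousEP. Qed.

Fact top_comp_idr (X Y : topologicalType) (u : continuousType X Y) :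
  top_comp u idfun = u.
Proof. exact/continuousEP. Qed.

Fact top_compA (X Y Z T : topologicalType) (w : continuousType Z T)
    (v : continuousType Y Z) (u : continuousType X Y) :
  top_comp w (top_comp v u) = top_comp (top_comp w v) u.
Proof. exact/continuousEP. Qed.

Definition Top : category := @Category topologicalType
  (fun X Y => continuousType X Y) (fun=> idfun) top_comp
  top_comp_idl top_comp_idr top_compA.

End top_category.

Section real_poset.
Variable R : realType.

Let le_comp (a b c : R) (v : b <= c) (u : a <= b) : a <= c := le_trans u v.

Fact le_comp_idl (a b : R) (u : a <= b) : le_comp (lexx b) u = u.
Proof. exact: bool_irrelevance. Qed.

Fact le_comp_idr (a b : R) (u : a <= b) : le_comp u (lexx a) = u.
Proof. exact: bool_irrelevance. Qed.

Fact le_compA (a b c d : R) (w : c <= d) (v : b <= c) (u : a <= b) :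
  le_comp w (le_comp v u) = le_comp (le_comp w v) u.
Proof. exact: bool_irrelevance. Qed.

Definition Rle_category : category := @Category R
  (fun a b => a <= b) (fun a => lexx a) le_comp
  le_comp_idl le_comp_idr le_compA.

Variable e : R.

Fact shift_mor (a b : R) (u : a <= b) : a + e <= b + e.
Proof. by rewrite lerD2r. Qed.

Fact shift_mor_id (a : R) : shift_mor (lexx a) = lexx (a + e).
Proof. exact: bool_irrelevance. Qed.

Fact shift_mor_comp (a b c : R) (v : b <= c) (u : a <= b) :
  shift_mor (le_comp v u) = le_comp (shift_mor v) (shift_mor u).
Proof. exact: bool_irrelevance. Qed.

Definition shift_functor : functor Rle_category Rle_category :=
  @Functor Rle_category Rle_category (fun a => a + e) shift_mor
    shift_mor_id shift_mor_comp.

Hypothesis e0 : 0 <= e.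

Fact le_shift2 (a : R) : a <= a + e + e.
Proof. by rewrite -addrA lerDl addr_ge0. Qed.

End real_poset.

Section interleaving.
Variables (R : realType) (D : category).
Implicit Types P Q : functor (Rle_category R) D.

(* The object [a + 2e] is written [a + e + e]: this is the value at [a] of the
   iterated shift, so that both sides of each equation have the same type. *)
Definition interleaved (e : R) (e0 : 0 <= e) P Q : Prop :=
  exists (phi : nat_trans P (Q \oF shift_functor e))
         (psi : nat_trans Q (P \oF shift_functor e)),
  forall a : R,
    psi (a + e) \oM phi a
      = fmor P (le_shift2 e0 a : @mor (Rle_category R) a (a + e + e)) /\
    phi (a + e) \oM psi a
      = fmor Q (le_shift2 e0 a : @mor (Rle_category R) a (a + e + e)).

Definition interleaving_distance P Q : \bar R :=
  ereal_inf [set e%:E | e in [set e : R | exists e0 : 0 <= e,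
                                            interleaved e0 P Q]].

End interleaving.

(* The supremum is taken in [[0, +oo]]; [ereal_sup] alone would give [-oo]
   when [X] is empty. *)
Definition sup_norm (R : realType) (X : Type) (h : X -> R) : \bar R :=
  maxe 0%E (ereal_sup [set `|h x|%:E | x in [set: X]]).

Section sublevel_functor.
Variables (R : realType) (X : topologicalType) (f : X -> R).

Definition sublevel (a : R) : set X := f @^-1` `]-oo, a].

Fact sublevelS (a b : R) : a <= b -> sublevel a `<=` sublevel b.
Proof. by move=> ab x; rewrite /sublevel /= !in_itv /= => /le_trans; apply. Qed.

Fact sublevel_incl_continuous (a b : R) (ab : a <= b) :
  continuous (subfun (sublevelS ab)).
Proof.
apply: continuous_comp_initial.
exact: (@initial_continuous (sublevel a) X set_val).
Qed.

Let sublevel_mor (a b : R) (ab : a <= b) :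
    continuousType (sublevel a) (sublevel b) :=
  mkcts (@sublevel_incl_continuous a b ab).

Fact sublevel_mor_id (a : R) : sublevel_mor (lexx a) = idfun.
Proof. by apply/continuousEP => x; exact/val_inj. Qed.

Fact sublevel_mor_comp (a b c : R) (bc : b <= c) (ab : a <= b) :
  sublevel_mor (le_trans ab bc) = (sublevel_mor bc \o sublevel_mor ab).
Proof. by apply/continuousEP => x; exact/val_inj. Qed.

(* [sublevel a] is coerced to the subtype [set_type (sublevel a)], whose
   topology is the initial one for the inclusion into [X]. *)
Definition sublevel_functor : functor (Rle_category R) Top :=
  @Functor (Rle_category R) Top (fun a => sublevel a : topologicalType)
    sublevel_mor sublevel_mor_id sublevel_mor_comp.

End sublevel_functor.

(* Main.v *)
Require Import Defs.
From mathcomp Require Import all_boot all_order all_algebra.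
From mathcomp Require Import boolp classical_sets functions set_interval.
From mathcomp Require Import reals ereal topology.

(** If [|f x - g x| <= e] for every [x], then [f x <= a] implies
    [g x <= a + e] and vice versa, so each sublevel set of one function is
    included in the sublevel set of the other at a level raised by [e].  These
    inclusions, continuous for the subspace topologies, form the two families
    of an [e]-interleaving: every diagram that has to commute consists of
    inclusions of subspaces of [X], and two such inclusions with the same ends
    are equal ([sublevel_functor_interleaved]).  An interleaving is a family of
    equations between composites, hence any functor [H] preserves it
    ([comp_functor_interleaved]).  When the sup norm of [f - g] is finite it is
    itself such an [e], hence bounds the infimum; when it is infinite there is
    nothing to prove. *)

Set Implicit Arguments.
Unset Strict Implicit.
Unset Printing Implicit Defensive.

Import Order.TTheory GRing.Theory Num.Theory.

Local Open Scope classical_set_scope.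
Local Open Scope ring_scope.

Section subspace_inclusion.
Variable X : topologicalType.

Lemma subfun_continuous (A B : set X) (AB : A `<=` B) :
  continuous (subfun AB : A -> B).
Proof.
apply: continuous_comp_initial.
exact: (@initial_continuous A X set_val).
Qed.

Definition subspace_incl (A B : set X) (AB : A `<=` B) : continuousType A B :=
  mkcts (@subfun_continuous A B AB).

End subspace_inclusion.

Section functor_image.
Variables (C D E : category) (H : functor D E) (P Q : functor C D).

Lemma whisker_naturality (phi : nat_trans P Q) (a b : C) (u : mor a b) :
  fmor H (phi b) \oM fmor (H \oF P) u = fmor (H \oF Q) u \oM fmor H (phi a).
Proof. by rewrite /= -!fmor_comp naturality. Qed.

End functor_image.

(** The families are retyped componentwise: [(H \oF Q) \oF shift_functor e] and
    [H \oF (Q \oF shift_functor e)] agree on objects and morphisms by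
    computation, although they carry different proofs of functoriality. *)
Lemma comp_functor_interleaved (R : realType) (D E : category)
    (H : functor D E) (P Q : functor (Rle_category R) D) (e : R)
    (e0 : 0 <= e) :
  interleaved e0 P Q -> interleaved e0 (H \oF P) (H \oF Q).
Proof.
move=> [phi [psi phi_psi]].
exists (@NatTrans _ _ (H \oF P) ((H \oF Q) \oF shift_functor e)
          (fun a => fmor H (phi a)) (whisker_naturality H phi)).
exists (@NatTrans _ _ (H \oF Q) ((H \oF P) \oF shift_functor e)
          (fun a => fmor H (psi a)) (whisker_naturality H psi)).
move=> a; have [psi_phi_a phi_psi_a] := phi_psi a.
by split; rewrite /= -fmor_comp ?psi_phi_a ?phi_psi_a.
Qed.

Section sublevel_shift.
Variables (R : realType) (X : topologicalType) (e : R).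

Lemma sublevel_shiftS (f g : X -> R) (gf : forall x, g x <= f x + e) (a : R) :
  sublevel f a `<=` sublevel g (a + e).
Proof.
move=> x; rewrite /sublevel /= !in_itv /= => fxa.
by rewrite (le_trans (gf x))// lerD2r.
Qed.

Lemma sublevel_shift_naturality (f g : X -> R)
    (gf : forall x, g x <= f x + e) (a b : Rle_category R) (ab : mor a b) :
  (subspace_incl (@sublevel_shiftS f g gf b) : @mor Top _ _)
    \oM fmor (sublevel_functor f) ab
  = fmor (sublevel_functor g \oF shift_functor e) ab
    \oM (subspace_incl (@sublevel_shiftS f g gf a) : @mor Top _ _).
Proof. by apply/continuousEP => x; exact/val_inj. Qed.

Definition sublevel_shift (f g : X -> R) (gf : forall x, g x <= f x + e) :
    nat_trans (sublevel_functor f) (sublevel_functor g \oF shift_functor e) :=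
  @NatTrans _ _ (sublevel_functor f) (sublevel_functor g \oF shift_functor e)
    (fun a => subspace_incl (@sublevel_shiftS f g gf a))
    (sublevel_shift_naturality gf).

Lemma sublevel_functor_interleaved (e0 : 0 <= e) (f g : X -> R) :
  (forall x, `|f x - g x| <= e) ->
  interleaved e0 (sublevel_functor f) (sublevel_functor g).
Proof.
move=> fg.
have gf x : g x <= f x + e.
  by rewrite addrC -lerBlDr (le_trans (ler_norm _))// distrC.
have {}fg x : f x <= g x + e.
  by rewrite addrC -lerBlDr (le_trans (ler_norm _)).
exists (sublevel_shift gf), (sublevel_shift fg) => a.
by split; apply/continuousEP => x; exact/val_inj.
Qed.

End sublevel_shift.

Lemma sup_norm_ge0 (R : realType) (X : Type) (h : X -> R) :
  (0 <= sup_norm h)%E.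
Proof. by rewrite /sup_norm le_max lexx. Qed.

Lemma sup_norm_ub (R : realType) (X : Type) (h : X -> R) (x : X) :
  (`|h x|%:E <= sup_norm h)%E.
Proof.
by rewrite /sup_norm le_max ereal_sup_ubound ?orbT//; exists x.
Qed.

Lemma interleaving_distance_le (R : realType) (D : category)
    (P Q : functor (Rle_category R) D) (e : R) (e0 : 0 <= e) :
  interleaved e0 P Q -> (interleaving_distance P Q <= e%:E)%E.
Proof. by move=> PQ; apply: ereal_inf_lbound; exists e => //; exists e0. Qed.

Unset Implicit Arguments.

Theorem theorem5p1 (R : realType) (X : topologicalType) (f g : X -> R)
    (D : category) (H : functor Top D) :
  (interleaving_distance (H \oF sublevel_functor f) (H \oF sublevel_functor g)
     <= sup_norm (f \- g)%R)%E.
Proof.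
have := sup_norm_ge0 (f \- g); have := sup_norm_ub (f \- g).
case: (sup_norm _) => [e fg e0| _ _|//]; last by rewrite leey.
rewrite lee_fin in e0.
apply: (@interleaving_distance_le _ _ _ _ _ e0).
apply: comp_functor_interleaved.
by apply: sublevel_functor_interleaved => x; rewrite -lee_fin; exact: fg.
Qed.
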